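(* Let $G$ be a countable, finitely generated amenable group and let $A$ be a finite set. There is a dense subset $C\subset[0,\log|A|]$ such that for each $c\in C$ there exists a strongly irreducible shift $X\subseteq A^G$ with $h(X)=c$, and where $X$ is an isolated point in the space $\mathfrak{S}_{\ge c}$ of shifts in $A^G$ with entropy at least $c$.
   Context: $A^G$ carries the product topology ($A$ discrete), and $G$ acts on it by $[gx](h)=x(g^{-1}h)$. A shift is a closed $G$-invariant subset $X\subseteq A^G$. For finite $K\subset G$, $x_K$ is the restriction of $x$ to $K$ and $X_K=\{x_K : x\in X\}$. The space $\mathfrak{S}$ of all shifts in $A^G$ has the Hausdorff topology, which is compact and Polish; $X^n\to X$ if and only if for every finite $K\subset G$ one has $X^n_K=X_K$ for all large enough $n$. Fix a left-invariant word metric $d$ on $G$, and let $B_r=\{g\in G: d(e,g)\le r\}$. For finite $F\subset G$ let $\partial_rF=\{g\in G: gB_r\cap F\ne\emptyset \text{ and } gB_r\cap(G\setminus F)\neq\emptyset\}$ and $\rho_r(F)=|\partial_rF|/|F|$. A sequence $(F_n)$ of finite subsets of $G$ is Følner if $\lim_n\rho_r(F_n)=0$ for every $r\in\mathbb{N}$. The entropy of a shift $X$ is $h(X)=\lim_{n\to\infty}\frac{1}{|F_n|}\log|X_{F_n}|$ for any Følner sequence $(F_n)$ (the limit exists and does not depend on the sequence). A shift $X$ is strongly irreducible if there is $r\in\mathbb{N}$ such that for all finite $K,H\subset G$ with $d(k,h)>r$ for all $k\in K$, $h\in H$, and all $x,y\in X$, there is $z\in X$ with $z_K=x_K$ and $z_H=y_H$.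 $\mathfrak{S}_{\ge c}=\{X\in\mathfrak{S}: h(X)\ge c\}$ with the subspace topology.
   Formalization: ''Countable'' is taken to mean countably infinite: for a finite group G and |A| ≥ 2 there are only finitely many shifts, hence finitely many entropies, so no dense C exists. *)

(* Defs.v *)
From HB Require Import structures.
From mathcomp Require Import all_boot all_order all_algebra.
From mathcomp Require Import finmap.
From mathcomp Require Import all_classical all_reals all_analysis.

Set Implicit Arguments.
Unset Strict Implicit.
Unset Printing Implicit Defensive.

Import Order.TTheory GRing.Theory Num.Theory.
Import numFieldNormedType.Exports.

Local Open Scope fset_scope.
Local Open Scope classical_set_scope.
Local Open Scope group_scope.

Section WordMetric.
Variables (G : groupType) (S : {fset G}).

Definition is_word (n : nat) (g : G) : Prop :=
  exists w : seq G,
    [/\ size w = n, all (fun s => (s \in S) || (s^-1 \in S)) w &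
        g = \big[*%g/1]_(s <- w) s].

Definition generates : Prop := forall g, exists n, is_word n g.

(* The default value 0 is only reached when [S] does not generate [G]. *)
Definition word_length (g : G) : nat :=
  xget 0%N [set n | is_word n g /\ forall m, is_word m g -> (n <= m)%N].

Definition word_dist (g h : G) : nat := word_length (g^-1 * h).

Definition word_ball (r : nat) : set G := [set g | (word_dist 1 g <= r)%N].

(* Finite when [S] generates [G] ([fset_set] sends infinite sets to [fset0]). *)
Definition boundary (r : nat) (F : {fset G}) : set G :=
  [set g | (exists2 b, word_ball r b & g * b \in F) /\
           (exists2 b, word_ball r b & g * b \notin F)].

Definition boundary_ratio (R : realType) (r : nat) (F : {fset G}) : R :=
  (#|` fset_set (boundary r F)|%:R / #|` F|%:R)%R.

(* Nonemptiness is needed because [x / 0 = 0] in a field. *)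
Definition Folner (R : realType) (F : nat -> {fset G}) : Prop :=
  (forall n, F n != fset0) /\
  (forall r, boundary_ratio R r (F n) @[n --> \oo] --> (0 : R)%R).

Definition amenable (R : realType) : Prop := exists F, Folner R F.

End WordMetric.

Definition config (G : groupType) (A : finType) : Type :=
  prod_topology (fun _ : G => discrete_topology A).

HB.instance Definition _ (G : groupType) (A : finType) :=
  Uniform.copy (config G A) (prod_topology (fun _ : G => discrete_topology A)).

Definition translate (G : groupType) (A : finType) (g : G) (x : config G A) :
  config G A := fun h => x (g^-1 * h).

Record shift_space (G : groupType) (A : finType) := Shift {
  shift_set :> set (config G A);
  shift_closed : closed shift_set;
  shift_invariant : forall g x, shift_set x -> shift_set (translate g x)
}.

HB.instance Definition _ (G : groupType) (A : finType) :=
  gen_eqMixin (shift_space G A).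
HB.instance Definition _ (G : groupType) (A : finType) :=
  gen_choiceMixin (shift_space G A).

Section HausdorffTopology.
Local Open Scope relation_scope.
Variables (G : groupType) (A : finType).

Definition hausdorff_rel (E : set (config G A * config G A)) :
    set (shift_space G A * shift_space G A) :=
  [set XY | let: (X, Y) := XY in
     (forall x, shift_set X x -> exists2 y, shift_set Y y & E (x, y)) /\
     (forall y, shift_set Y y -> exists2 x, shift_set X x & E (x, y))].

(* The uniformity induced by the Hausdorff metric, for any metric inducing the
   product uniformity of [A^G]; the empty shift is isolated. *)
Definition hausdorff_ent : set_system (shift_space G A * shift_space G A) :=
  filter_from (@entourage (config G A)) hausdorff_rel.

Let hausdorff_filter : Filter hausdorff_ent.
Proof.
apply: filter_from_filter; first by exists setT; exact: entourageT.
move=> E F entE entF; exists (E `&` F); first exact: filterI.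
move=> [X Y] [/= XY YX]; split; split=> /= x.
- by move=> /XY[y ? []]; exists y.
- by move=> /YX[y ? []]; exists y.
- by move=> /XY[y ? []]; exists y.
- by move=> /YX[y ? []]; exists y.
Qed.

Let hausdorff_diagonal D : hausdorff_ent D -> diagonal `<=` D.
Proof.
move=> [E entE sED] [X Y] /diagonalP ->; apply: sED.
by split=> x Xx; exists x => //; exact: entourage_refl.
Qed.

Let hausdorff_inv D : hausdorff_ent D -> hausdorff_ent D^-1.
Proof.
move=> [E entE sED]; exists E^-1; first exact: entourage_inv.
by move=> [X Y] [XY YX]; apply: sED; split.
Qed.

Let hausdorff_split D : hausdorff_ent D ->
  exists2 D', hausdorff_ent D' & D' \; D' `<=` D.
Proof.
move=> [E entE sED]; have [F entF sFE] := entourage_split_ex entE.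
exists (hausdorff_rel F); first by exists F.
move=> [X Z] [Y /= [/= XY YX] [/= YZ ZY]]; apply: sED; split=> /= u.
- by move=> /XY[v /YZ[w Zw Fvw] Fuv]; exists w => //; apply: sFE; exists v.
- by move=> /ZY[v /YX[w Xw Fwv] Fvu]; exists w => //; apply: sFE; exists v.
Qed.

HB.instance Definition _ := isUniform.Build (shift_space G A)
  hausdorff_filter hausdorff_diagonal hausdorff_inv hausdorff_split.

End HausdorffTopology.

Definition restr (G : groupType) (A : finType) (K : {fset G})
  (x : config G A) : {ffun K -> A} := [ffun k : K => x (val k)].

Definition patterns (G : groupType) (A : finType) (X : set (config G A))
  (K : {fset G}) : set {ffun K -> A} := restr K @` X.
Arguments patterns {G A} X K.

Section Entropy.
Variables (R : realType) (G : groupType) (S : {fset G}) (A : finType).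
Local Open Scope ereal_scope.

(* [lne 0 = -oo], so the empty shift has entropy [-oo]. *)
Definition pattern_entropy (X : set (config G A)) (K : {fset G}) : \bar R :=
  (#|` K|%:R^-1)%R%:E * lne (#|` fset_set (patterns X K)|%:R)%:E.

Definition entropy (X : shift_space G A) : \bar R :=
  get [set h : \bar R | forall F, Folner S R F ->
                          pattern_entropy X (F n) @[n --> \oo] --> h].

Definition shifts_ge (c : R) : set (shift_space G A) :=
  [set X | c%:E <= entropy X].

Definition strongly_irreducible (X : shift_space G A) : Prop :=
  exists r : nat, forall K H : {fset G},
    (forall k h, k \in K -> h \in H -> (r < word_dist S k h)%N) ->
    forall x y, shift_set X x -> shift_set X y ->
    exists z, [/\ shift_set X z, restr K z = restr K x &
                  restr H z = restr H y].

End Entropy.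
Arguments shifts_ge {R G} S A c.

(* Main.v *)
(* The shifts are X(W, m): configurations in which every window g W carries at
   most m symbols different from a fixed a0. Since a0 may be written anywhere,
   X(W, m) is strongly irreducible, and a shift close to it is contained in it.

   Isolation. If X is strongly irreducible and Y is a proper subshift, Y misses a
   pattern p of X. On a positive proportion of well separated translates, each
   requirement of avoiding p costs a fixed factor in the number of patterns,
   because p can be pasted into any element of X. Hence h(Y) < h(X).

   Existence of h(X). Shearer's inequality for the translates of E meeting F gives
   log |X_F| / |F| <= (1 + o(1)) log |X_E| / |E| along any Folner sequence, so the
   limit is the infimum of log |X_E| / |E| over finite nonempty E.

   Density. Take |W| = J^4 and let m go from J^3 to J^4, where X(W, m) is the full
   shift. For m = J^3, configurations have density of symbols other than a0 at most
   2/J, so the entropy is small. From m + 1 to m the entropy drops little: the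
   windows with m + 1 such symbols are met by a set M of at most 2 |F| / J of these
   symbols (greedy hitting set), and erasing M maps X(W, m + 1) into X(W, m). *)
Require Import Defs.
From HB Require Import structures.
From mathcomp Require Import all_boot all_order all_algebra.
From mathcomp Require Import finmap.
From mathcomp Require Import all_classical all_reals all_analysis.
From mathcomp Require Import lra ring zify.

Set Implicit Arguments.
Unset Strict Implicit.
Unset Printing Implicit Defensive.

Import Order.TTheory GRing.Theory Num.Theory.
Import numFieldNormedType.Exports.

Local Open Scope fset_scope.
Local Open Scope classical_set_scope.

(** * Counting *)

(** With [f] a restriction map this is |X_K|. Counting through the points of [S] lets bounds come
    from maps between configurations. *)
Definition nval (T : Type) (U : finType) (S : set T) (f : T -> U) : nat :=
  #|[pred u : U | `[< exists2 x, S x & f x = u >]]|.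

Section NumberOfValues.
Variables (T : Type).
Implicit Types (S : set T).

(** Fix one representative [y] for each value [u] of [f]. Sending [u] to [g (h y)] is then
    injective, even if [h] does not respect the values of [f]. *)
Lemma nval_le (T' : Type) (U V : finType) S (S' : set T') (f : T -> U)
    (g : T' -> V) (h : T -> T') :
  (forall x, S x -> S' (h x)) ->
  (forall x y, S x -> S y -> g (h x) = g (h y) -> f x = f y) ->
  (nval S f <= nval S' g)%N.
Proof.
move=> hS inj; rewrite /nval.
have ex (u : U) : exists o : option V,
    forall x, S x -> f x = u -> exists2 y, S y /\ f y = u & o = Some (g (h y)).
  have [[y Sy fy]|no] := pselect (exists2 y, S y & f y = u).
    by exists (Some (g (h y))) => x _ _; exists y.
  by exists None => x Sx fx; case: no; exists x.
pose c u := sval (cid (ex u)).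
rewrite -(fintype.card_in_image (f := c)).
  have someI : injective (@Some V) by move=> ? ? [].
  rewrite -[leqRHS](fintype.card_image someI).
  apply/subset_leq_card/fintype.subsetP => o /fintype.imageP[u /asboolP[x Sx fx] ->].
  have [y [Sy _] e] := svalP (cid (ex u)) x Sx fx.
  rewrite /c e; apply/fintype.image_f/asboolP; exists (h y) => //; exact: hS.
move=> u v /asboolP[x Sx fx] /asboolP[x' Sx' fx'] cE.
have [y [Sy fy] e] := svalP (cid (ex u)) x Sx fx.
have [y' [Sy' fy'] e'] := svalP (cid (ex v)) x' Sx' fx'.
move: cE; rewrite /c e e' => -[cE].
by rewrite -fy -fy'; apply: inj.
Qed.

Lemma nval_gt0 (U : finType) S (f : T -> U) x : S x -> (0 < nval S f)%N.
Proof. by move=> Sx; apply/card_gt0P; exists (f x); apply/asboolP; exists x. Qed.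

Lemma nval_eq0 (U : finType) S (f : T -> U) : S = set0 -> nval S f = 0%N.
Proof.
by move=> ->; apply: eq_card0 => u; rewrite inE; apply/asboolP => -[].
Qed.

Lemma nval_fset_set (U : finType) S (f : T -> U) :
  #|` fset_set (f @` S)| = nval S f.
Proof.
rewrite -(card_uniqP (fset_uniq _)); apply: eq_card => u.
rewrite (in_fset_set finite_finset) !inE.
by apply: asbool_equiv_eq; split=> -[x Sx]; exists x.
Qed.

Lemma nval_pair (U V : finType) S (f : T -> U) (g : T -> V) :
  (nval S (fun x => (f x, g x)) <= nval S f * nval S g)%N.
Proof.
rewrite -cardX; apply/subset_leq_card/fintype.subsetP => -[u v] /asboolP[x Sx [<- <-]].
by rewrite !inE; apply/andP; split; apply/asboolP; exists x.
Qed.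

Lemma nval_split (U V : finType) S (f : T -> U) (g : T -> V) :
  (forall x y, S x -> S y -> f x = f y -> g x = g y) ->
  nval S f = (\sum_v nval (S `&` [set x | g x = v]) f)%N.
Proof.
move=> fg; rewrite /nval -sum1_card.
transitivity (\sum_(u in [pred u | `[< exists2 x, S x & f x = u >]])
   \sum_(v | `[< exists2 x, S x /\ g x = v & f x = u >]) 1)%N.
  apply: eq_bigr => u /asboolP[x Sx fx].
  rewrite (big_pred1 (g x)) // => v; apply/asboolP/eqP => [[y [Sy <-] fy]|->].
    by apply: fg => //; rewrite fx.
  by exists x.
rewrite (exchange_big_dep predT) //=; apply: eq_bigr => v _.
rewrite -sum1_card; apply: eq_bigl => u; rewrite !inE.
apply/andP/asboolP => [[_ /asboolP//]|[x [Sx gx] fx]].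
by split; apply/asboolP; exists x.
Qed.

End NumberOfValues.

Lemma card_fset_filter (K : choiceType) (V : {fset K}) (P : pred K) :
  #|` [fset v in V | P v]| = (\sum_(v <- V) P v)%N.
Proof.
by rewrite card_fset_sum1 -big_fset_condE big_mkcond; apply: eq_bigr => v _; case: (P v).
Qed.

Lemma double_counting (T U : choiceType) (V : {fset T}) (D : {fset U})
    (inc : U -> T -> bool) :
  (\sum_(d <- D) #|` [fset v in V | inc d v]| =
   \sum_(v <- V) #|` [fset d in D | inc d v]|)%N.
Proof.
under eq_bigr do rewrite card_fset_filter.
rewrite exchange_big; apply: eq_bigr => v _.
by rewrite card_fset_filter.
Qed.

Lemma sum_const_fset (K : choiceType) (V : {fset K}) n :
  (\sum_(v <- V) n = n * #|` V|)%N.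
Proof. by rewrite big_const_seq count_predT iter_addn_0. Qed.

Section HittingSet.
Local Open Scope fset_scope.
Variables (T U : choiceType) (V : {fset T}) (inc : U -> T -> bool) (m q : nat).
Hypothesis (m_gt0 : (0 < m)%N) (q_gt0 : (0 < q)%N).

(* Greedily pick points lying on at least [q] of the remaining edges; by double
   counting at most [q |V| / m] edges are left once there is no such point. *)
Lemma hitting_set (D : {fset U}) :
  (forall d, d \in D -> (m <= #|` [fset v in V | inc d v]|)%N) ->
  exists M : {fset T}, [/\ (M `<=` V)%fset,
    forall d, d \in D -> exists2 v, v \in M & inc d v &
    (q * m * #|` M| <= m * #|` D| + q ^ 2 * #|` V|)%N].
Proof.
have [n] := ubnP #|` D|; elim: n D => // n IHn D ltDn degD.
pose E v := [fset d in D | inc d v].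
have [[v Vv qE]|small] := pselect (exists2 v, v \in V & (q <= #|` E v|)%N).
  have ED : (E v `<=` D)%fset by apply/fsubsetP => d; rewrite !inE => /andP[].
  have cD : #|` (D `\` E v)%fset| = (#|` D| - #|` E v|)%N by rewrite cardfsDS.
  have leED := fsubset_leq_card ED.
  have [|d|M [MV hit cM]] := IHn (D `\` E v)%fset; first by rewrite cD; lia.
    by rewrite !inE => /andP[_ dD]; apply: degD.
  exists (v |` M); split.
  - by apply/fsubsetP => w; rewrite !inE => /orP[/eqP->//|]; apply/fsubsetP: w.
  - move=> d dD; have [dv|dv] := boolP (inc d v).
      by exists v; rewrite ?fset1U1.
    have [|w wM dw] := hit d; first by rewrite !inE (negbTE dv) andbF dD.
    by exists w; rewrite // fset1Ur.
  (* The new point costs [q * m], paid for by at least [q] edges leaving [D], each of weight [m]. *)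
  - have : (#|` v |` M| <= 1 + #|` M|)%N by rewrite cardfsU1; lia.
    move: cM; rewrite cD mulnBr => cM cvM.
    have := leq_mul (leqnn (q * m)) cvM; have := leq_mul (leqnn m) qE.
    have := leq_mul (leqnn m) leED; rewrite mulnDr muln1 [(q * m)%N]mulnC => *; lia.
have deg v : v \in V -> (#|` E v| <= q)%N.
  by move=> Vv; rewrite leqNgt; apply/negP => /ltnW ?; apply: small; exists v.
have pick d : d \in D -> exists2 v, v \in V & inc d v.
  move=> /degD /(leq_trans m_gt0); rewrite cardfs_gt0 => /fset0Pn[v].
  by rewrite !inE => /andP[]; exists v.
have count : (m * #|` D| <= q * #|` V|)%N.
  rewrite -!sum_const_fset.
  apply: (@leq_trans (\sum_(d <- D) #|` [fset v in V | inc d v]|)%N).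
    by rewrite big_seq [leqRHS]big_seq; apply: leq_sum => d /degD.
  by rewrite double_counting big_seq [leqRHS]big_seq; apply: leq_sum => v /deg.
have [M [MV hit cM]] : exists M : {fset T}, [/\ (M `<=` V)%fset,
    forall d, d \in D -> exists2 v, v \in M & inc d v & (#|` M| <= #|` D|)%N].
  pose pk (d : D) := sval (cid2 (pick _ (valP d))).
  exists [fset pk d | d : D]; split.
  - apply/fsubsetP => v /imfsetP[d _ ->]; exact: (s2valP (cid2 (pick _ (valP d)))).
  - move=> d dD; exists (pk [` dD]); first exact: in_imfset.
    exact: (s2valP' (cid2 (pick _ (valP [` dD])))).
  - rewrite [leqRHS]cardfE cardE; exact: leq_imfset_card.
exists M; split => //; have := leq_mul (leqnn (q * m)) cM.
have := leq_mul (leqnn q) count; rewrite !mulnA mulnn => *; lia.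
Qed.

End HittingSet.

(* The k-th power of Hölder's inequality, with exponents k on [Q] and infinity
   off [Q]. *)
Lemma holder_count (R : realType) (I J : finType) (k : nat)
    (n : J -> nat) (f : I -> J -> nat) (t : I -> nat) (Q : {set I}) :
  (0 < k)%N -> #|Q| = k ->
  (forall a, (n a ^ k <= \prod_i f i a)%N) ->
  (forall i a, (f i a <= t i)%N) -> (forall i, (0 < t i)%N) ->
  (forall i, i \in Q -> (\sum_a f i a <= t i)%N) ->
  ((\sum_a n a) ^ k <= \prod_i t i)%N.
Proof.
move=> k0 cQ nf ft t0 sumf.
pose T : R := ((\prod_i t i)%N%:R)%R.
have T0 : (0 < T)%R by rewrite ltr0n prodn_gt0.
(* By AM-GM, [n a / tau] is at most the mean over [Q] of the ratios [y i a]; factors off [Q] are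
   bounded by [t i]. Summed over [a], this mean is at most 1. *)
pose tau : R := (T `^ (k%:R^-1))%R.
have tauk : (tau ^+ k = T)%R.
  by rewrite -powR_mulrn ?powR_ge0// -powRrM mulVf ?powRr1 ?ltW// pnatr_eq0 -lt0n.
have tau0 : (0 <= tau)%R by exact: powR_ge0.
have k0R : (0 < k%:R :> R)%R by rewrite ltr0n.
pose y i a : R := ((f i a)%:R / (t i)%:R)%R.
have y0 i a : (0 <= y i a)%R by rewrite divr_ge0.
have na a : ((n a)%:R <= tau * ((\sum_(i in Q) y i a) / k%:R))%R.
  rewrite -(@ler_pXn2r _ k)// ?nnegrE ?mulr_ge0 ?divr_ge0 ?sumr_ge0//.
  rewrite exprMn tauk -natrX.
  apply: (@le_trans _ _ (T * \prod_(i in Q) y i a)%R).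
    apply: (@le_trans _ _ (\prod_i f i a)%N%:R)%R; first by rewrite ler_nat.
    rewrite /T !natr_prod (bigID (mem Q)) [in leRHS](bigID (mem Q)) /=.
    rewrite mulrAC -big_split /=; apply: ler_pM; try exact: prodr_ge0.
      rewrite le_eqVlt; apply/orP; left; apply/eqP/eq_bigr => i _.
      by rewrite /y mulrC divfK// pnatr_eq0 -lt0n.
    by apply: ler_prod => i _; rewrite ler0n ler_nat ft.
  rewrite ler_pM2l//.
  by have /leifP := @leif_AGM R I (mem Q) (y^~ a) (fun i _ => y0 i a);
    rewrite cQ; case: ifP => _ => [/eqP->|/ltW].
rewrite -(@ler_nat R) natrX -/T -tauk ler_pXn2r// ?nnegrE// natr_sum.
apply: (le_trans (ler_sum _ (fun a _ => na a))).
rewrite -mulr_sumr -mulr_suml ler_piMr// ler_pdivrMr// mul1r.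
rewrite exchange_big /= -cQ -sumr_const.
apply: ler_sum => i iQ; rewrite /y -mulr_suml ler_pdivrMr ?ltr0n//.
by rewrite mul1r -natr_sum ler_nat sumf.
Qed.

(** * Shearer's inequality for patterns *)

Section Shearer.
Variables (G : groupType) (A : finType).
Implicit Types (S : set (config G A)) (K F : {fset G}).

Definition count S K : nat := nval S (restr K).

Lemma restrP K (x y : config G A) :
  restr K x = restr K y <-> forall k, k \in K -> x k = y k.
Proof.
split=> [/ffunP xy k Kk|xy]; first by have := xy [` Kk]; rewrite !ffunE.
by apply/ffunP => k; rewrite !ffunE; apply: xy; exact: valP.
Qed.

Lemma count_le S S' K F :
  S `<=` S' -> {subset K <= F} -> (count S K <= count S' F)%N.
Proof.
move=> SS KF; apply: (nval_le (h := id)) => // x y _ _ /restrP xy.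
by apply/restrP => k /KF; apply: xy.
Qed.

Lemma count_split S K v : v \in K ->
  count S K = (\sum_a count (S `&` [set x | x v = a]) K)%N.
Proof. by move=> Kv; apply: nval_split => x y _ _ /restrP; apply. Qed.

Lemma count_fset1U S F v a :
  count (S `&` [set x | x v = a]) (v |` F)%fset =
  count (S `&` [set x | x v = a]) F.
Proof.
apply/eqP; rewrite eqn_leq; apply/andP; split; last first.
  by apply: count_le => // k; rewrite !inE => ->; rewrite orbT.
apply: (nval_le (h := id)) => // x y [_ /= xv] [_ /= yv] /restrP xy.
by apply/restrP => k; rewrite !inE => /orP[/eqP->|/xy//]; rewrite xv yv.
Qed.

Lemma card_pattern K : #|{ffun K -> A}| = (#|A| ^ #|` K|)%N.
Proof. by rewrite card_ffun cardfE. Qed.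

Lemma count_max S K : (count S K <= #|A| ^ #|` K|)%N.
Proof. by rewrite -card_pattern; exact: max_card. Qed.

(** Induction on [F], for all [S] at once. Splitting [S] by the symbol at a new point [v] makes the
    counts on the [k] sets through [v] add up, while those on the other sets only decrease;
    [holder_count] recombines the pieces. *)
Lemma shearer (R : realType) (I : finType) (E : I -> {fset G}) (k : nat) F S :
  (0 < k)%N -> (forall v, v \in F -> #|[set i | v \in E i]%SET| = k) ->
  (count S F ^ k <= \prod_i count S (E i))%N.
Proof.
move=> k0; elim/fset1U_rect: F S => [|v F vF IHF] S degE.
  (* Over the empty set there is at most one pattern. If there is one, [S] is nonempty and every
     factor on the right is positive. *)
  have := count_max S fset0; rewrite cardfs0 expn0 leq_eqVlt ltnS leqn0.
  case/orP => /eqP c0; last by rewrite c0 exp0n.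
  have /card_gt0P[u /asboolP[x Sx _]] : (0 < count S fset0)%N by rewrite c0.
  by rewrite c0 exp1n; apply: prodn_gt0 => i; apply: nval_gt0 Sx.
have [[x Sx]|S0] := pselect (exists x, S x); last first.
  by rewrite /count nval_eq0 ?exp0n//; apply/eqP/negPn/negP => /set0P.
rewrite (@count_split _ _ v) ?fset1U1//.
under eq_bigr do rewrite count_fset1U.
apply: (@holder_count R _ _ _ _ (fun i a => count (S `&` [set x | x v = a]) (E i))
  _ [set i | v \in E i]%SET k0); first by apply: degE; rewrite fset1U1.
- by move=> a; apply: IHF => w wF; apply: degE; rewrite fset1Ur.
- by move=> i a; apply: count_le => // y [].
- by move=> i; apply: nval_gt0 Sx.
- by move=> i; rewrite inE => vE; rewrite -count_split.
Qed.

End Shearer.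

(** * Number of sparse patterns *)

Section SparsePatterns.
Local Open Scope ring_scope.
Variables (R : realType) (A : finType) (a0 : A).

(** The factor 2 is the one that both [count_window_bottom] and [sparse_hitting_set] produce. *)
Definition sparse (T : finType) (J : nat) : pred {ffun T -> A} :=
  [pred y : {ffun T -> A} | (J * #|[pred k | y k != a0]| <= 2 * #|T|)%N].

(** Chernoff's argument: weight a pattern by [x] to the number of its symbols other than [a0]. The
    total weight factors over the sites, and a sparse pattern weighs at least the power of [x] on
    the left because [x <= 1]. *)
Lemma card_sparse_weight (T : finType) (J : nat) (x : R) :
  (0 < J)%N -> 0 < x -> x <= 1 ->
  #|@sparse T J|%:R * x ^+ ((2 * #|T|) %/ J) <= (1 + #|A|%:R * x) ^+ #|T|.
Proof.
move=> J0 x0 x1; set t := (_ %/ _)%N.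
have -> : (1 + #|A|%:R * x) ^+ #|T| = \prod_(k : T) (1 + #|A|%:R * x).
  by rewrite prodr_const.
apply: (@le_trans _ _ (\prod_(k : T) \sum_(a : A) x ^+ (a != a0))); last first.
  apply: ler_prod => k _; rewrite sumr_ge0 /=; last first.
    by move=> a _; rewrite exprn_ge0// ltW.
  rewrite (bigD1 a0)//= eqxx expr0 lerD2l.
  rewrite mulr_natl -sumr_const [leRHS](bigD1 a0)//= -[leLHS]add0r.
  by apply: lerD; [exact: ltW|apply: ler_sum => a ->].
rewrite bigA_distr_bigA /= mulr_natl -sumr_const.
rewrite [leRHS](bigID (fun f => f \in @sparse T J)) /= -[leLHS]addr0.
apply: lerD; last first.
  by apply: sumr_ge0 => f _; apply: prodr_ge0 => k _; rewrite exprn_ge0// ltW.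
apply: ler_sum => f; rewrite inE => fJ.
rewrite prodrXr ler_wiXn2l// ?ltW//.
have -> : (\sum_i (f i != a0) = #|[pred k | f k != a0]|)%N.
  by rewrite -sum1_card [RHS]big_mkcond; apply: eq_bigr => i _; rewrite inE; case: (_ != _).
by rewrite leq_divRL// mulnC.
Qed.

(** First [x] is taken small, so that [ln (1 + c * x)] costs at most [eps / 2] per site; then [J] is
    taken large in terms of [x], uniformly in [T]. *)
Lemma card_sparse (eps : R) : 0 < eps -> exists J : nat, (0 < J)%N /\
  forall T : finType, ln (#|@sparse T J|%:R) <= eps * #|T|%:R.
Proof.
move=> eps0; pose c : R := #|A|%:R.
have c0 : 0 < c by rewrite ltr0n; apply/card_gt0P; exists a0.
pose x := Num.min 1 (eps / (2 * c)).
have x0 : 0 < x by rewrite lt_min ltr01 divr_gt0// mulr_gt0.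
have x1 : x <= 1 by rewrite ge_min lexx.
have xc : c * x <= eps / 2.
  have : x <= eps / (2 * c) by rewrite ge_min lexx orbT.
  by rewrite ler_pdivlMr ?mulr_gt0// => ?; rewrite ler_pdivlMr//; lra.
have lnx : ln x <= 0 by exact: ln_le0.
have lnx0 : 0 <= - ln x * 4 / eps.
  by rewrite mulr_ge0 ?invr_ge0 ?(ltW eps0)// mulr_ge0// oppr_ge0.
(* As [t <= 2 |T| / J], the constant 4 gives [- ln x * t <= eps / 2 * |T|]. *)
have [J hJ] : exists J : nat, - ln x * 4 / eps < J%:R.
  by exists (Num.bound (- ln x * 4 / eps)); exact: archi_boundP.
have J0R : 0 < J%:R :> R.
  exact: le_lt_trans hJ.
have J0 : (0 < J)%N by move: J0R; rewrite ltr0n.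
exists J; split=> // T.
have n0 : 0 < #|@sparse T J|%:R :> R.
  rewrite ltr0n; apply/card_gt0P; exists [ffun=> a0]; rewrite inE.
  by rewrite eq_card0 ?muln0// => k; rewrite inE ffunE eqxx.
have := card_sparse_weight T J0 x0 x1; set t := (_ %/ _)%N => H.
have tJ : t%:R * J%:R <= 2 * #|T|%:R :> R.
  by rewrite -!natrM ler_nat leq_trunc_div.
have : ln (#|@sparse T J|%:R) + t%:R * ln x <= #|T|%:R * (c * x).
  rewrite mulr_natl -lnXn// -lnM ?posrE ?exprn_gt0//.
  apply: (@le_trans _ _ (ln ((1 + c * x) ^+ #|T|))).
    by rewrite ler_ln ?posrE ?mulr_gt0 ?exprn_gt0// addr_gt0 ?mulr_gt0.
  rewrite lnXn ?addr_gt0 ?mulr_gt0// mulr_natl lerMn2r; apply/orP; right.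
  by apply: le_ln1Dx; apply: lt_trans (mulr_gt0 c0 x0); rewrite ltrN10.
move: hJ; rewrite ltr_pdivrMr// => hJ.
have : - ln x * t%:R <= eps / 2 * #|T|%:R.
  have h1 : - ln x * t%:R * 4 <= J%:R * eps * t%:R by have := ler0n R t; nra.
  have h2 : J%:R * eps * t%:R <= eps * (2 * #|T|%:R).
    rewrite -mulrA mulrCA ler_pM2l// mulrC; exact: tJ.
  lra.
have : #|T|%:R * (c * x) <= #|T|%:R * (eps / 2) by rewrite ler_wpM2l.
lra.
Qed.

End SparsePatterns.

(** * Word metric and boundaries *)

Section WordMetric.
Local Open Scope group_scope.
Variables (G : groupType) (S : {fset G}).
Hypothesis (genS : generates S).
Implicit Types (F K : {fset G}) (g b : G) (r : nat).

Lemma word_length_word g : is_word S (word_length S g) g.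
Proof.
rewrite /word_length; case: xgetP => [n _ []//|/= noP]; exfalso.
have ex : exists n, `[< is_word S n g >].
  by have [n ?] := genS g; exists n; apply/asboolP.
case: (ex_minnP ex) => n /asboolP wn nmin; apply: (noP n); split=> // m /asboolP.
exact: nmin.
Qed.

Lemma word_length_le n g : is_word S n g -> (word_length S g <= n)%N.
Proof.
move=> wn; rewrite /word_length; case: xgetP => [m _ [_]|_//].
exact.
Qed.

Lemma word_ballE r g : word_ball S r g <-> (word_length S g <= r)%N.
Proof. by rewrite /word_ball /= /word_dist invg1 mul1g. Qed.

Lemma word_ball1 r : word_ball S r 1.
Proof.
apply/word_ballE; apply: (@leq_trans 0%N) => //; apply: word_length_le.
by exists [::]; split=> //; rewrite big_nil.
Qed.

Lemma finite_word_ball r : finite_set (word_ball S r).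
Proof.
pose gens := (S `|` [fset s^-1 | s in S])%fset.
pose W := fix W n : {fset G} := if n is m.+1
  then [fset s * g | s in gens, g in W m]%fset else [fset 1]%fset.
have WP n g : is_word S n g -> g \in W n.
  elim: n g => [|n IHn] g [w [sw aw ->]].
    by move/size0nil: sw => ->; rewrite big_nil /= inE.
  case: w sw aw => // s w [sw] /= /andP[sS aw]; rewrite big_cons.
  apply: in_imfset2; last by apply: IHn; exists w.
  rewrite inE; case/orP: sS => [->//|sS]; apply/orP; right.
  by apply/imfsetP; exists s^-1 => //; rewrite invgK.
apply: (sub_finite_set _ (finite_fset (\bigcup_(n <- iota 0 r.+1) W n)%fset)).
move=> g /word_ballE gr; apply/bigfcupP; exists (word_length S g).
  by rewrite mem_iota andbT.
exact/WP/word_length_word.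
Qed.

Lemma sub_word_ball K : exists r, forall k, k \in K -> word_ball S r k.
Proof.
exists (\max_(k <- K) word_length S k)%N => k kK; apply/word_ballE.
exact: leq_bigmax_seq.
Qed.

Lemma finite_boundary r F : finite_set (boundary S r F).
Proof.
pose B := fset_set (word_ball S r).
apply: (sub_finite_set _ (finite_fset [fset f * b^-1 | f in F, b in B]%fset)).
move=> g [[b Bb gb] _] /=; apply/imfset2P; exists (g * b) => //.
by exists b; rewrite ?mulgK// in_fset_set ?inE//; exact: finite_word_ball.
Qed.

(** The set counted consists of the [g] for which [g K] meets [F]. If such a [g] is outside [F],
    then 1 and some [k] in [K] show that it is a boundary point. *)
Lemma card_boundary_out r F K : (forall k, k \in K -> word_ball S r k) ->
  (#|` [fset (f * k^-1)%g | f in F, k in K]%fset| <=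
    #|` F| + #|` fset_set (boundary S r F)|)%N.
Proof.
move=> Kr; set X := [fset _ | _ in _, _ in _]%fset.
have XF : (X `<=` F `|` fset_set (boundary S r F))%fset.
  apply/fsubsetP => _ /imfset2P[f /= fF [k /= kK ->]].
  rewrite inE; have [//|gF] := boolP (f * k^-1 \in F).
  rewrite in_fset_set ?inE; last exact: finite_boundary.
  split; first by exists k; [exact: Kr|rewrite mulgVK].
  by exists 1; [exact: word_ball1|rewrite mulg1].
apply: leq_trans (fsubset_leq_card XF) _; exact: leq_card_fsetU.
Qed.

(** A point [g] of [F] for which [g K] leaves [F] is a boundary point, again because 1 is in the
    ball. *)
Lemma card_boundary_in r F K : (forall k, k \in K -> word_ball S r k) ->
  (#|` F| <= #|` [fset g in F | all (fun k => (g * k)%g \in F) K]%fset| +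
    #|` fset_set (boundary S r F)|)%N.
Proof.
move=> Kr; set X := [fset _ in _ | _]%fset.
have FX : (F `<=` X `|` fset_set (boundary S r F))%fset.
  apply/fsubsetP => g gF; rewrite !inE gF /=.
  have [//|/allPn[k kK gk]] := boolP (all _ _).
  rewrite in_fset_set ?inE; last exact: finite_boundary.
  split; first by exists 1; [exact: word_ball1|rewrite mulg1].
  by exists k; [exact: Kr|].
apply: leq_trans (fsubset_leq_card FX) _; exact: leq_card_fsetU.
Qed.

(* Greedy choice: the right condition only constrains later picks, which is
   all that the successive modification of configurations uses. *)
Lemma separated_subset (Z F : {fset G}) : 1 \in Z -> exists s : seq G,
  [/\ {subset s <= F}, pairwise (fun g g' => g' \notin [fset g * z | z in Z]%fset) s &
      (#|` F| <= #|` Z| * size s)%N].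
Proof.
move=> Z1; have [n] := ubnP #|` F|; elim: n F => // n IHn F ltFn.
have [->|/fset0Pn[g gF]] := eqVneq F fset0; first by exists [::]; rewrite cardfs0.
pose gZ := [fset g * z | z in Z]%fset.
have cgZ : (#|` gZ| <= #|` Z|)%N by exact: leq_imfset_card.
have gZg : g \in gZ by apply/imfsetP; exists 1; rewrite ?mulg1.
have [|s [sF ps cs]] := IHn (F `\` gZ)%fset.
  rewrite -ltnS; apply: leq_trans ltFn; rewrite ltnS; apply: fproper_ltn_card.
  rewrite fproperE fsubsetDl /=.
  by apply/fsubsetPn; exists g; rewrite // inE gZg.
exists (g :: s); split.
- by move=> x; rewrite inE => /orP[/eqP->//|/sF]; rewrite inE => /andP[].
- by rewrite /= ps andbT; apply/allP => x /sF; rewrite inE => /andP[].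
- move: cs; rewrite cardfsD /= mulnS.
  rewrite leq_subLR => cs; apply: leq_trans cs _; rewrite leq_add2r.
  exact: leq_trans (fsubset_leq_card (fsubsetIr F gZ)) cgZ.
Qed.

End WordMetric.

(** * Shifts with few symbols in each window *)

Section Cylinders.
Variables (G : groupType) (A : finType).
Implicit Types (x y : config G A) (K : {fset G}).

(** The product uniformity is a supremum of uniformities [U i] pulled back along the coordinates, so
    an entourage of [U g] is one of the product; on a discrete factor the diagonal is an
    entourage. *)
Lemma entourage_coordinate (g : G) :
  entourage [set p : config G A * config G A | p.1 g = p.2 g].
Proof.
pose U i := Uniform.Pack (Uniform.class
  (initial_topology (@proj _ (fun _ : G => discrete_topology A) i))).
pose E := [set p : config G A * config G A | p.1 g = p.2 g].
have entE : `[< @entourage (U g) E >].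
  apply/asboolP; exists [set p | p.1 = p.2] => //.
  by move=> [a b] [c _ [<- <-]].
exists E => //.
exact: (@finI_from1 _ _ setT _
  (exist (fun p : {classic G} * _ => is_true `[< @entourage (U p.1) p.2 >])
    (g : {classic G}, E) entE)).
Qed.

Lemma entourage_cylinder K :
  entourage [set p : config G A * config G A | restr K p.1 = restr K p.2].
Proof.
have -> : [set p : config G A * config G A | restr K p.1 = restr K p.2] =
    \bigcap_(g in [set` K]) [set p | p.1 g = p.2 g].
  by apply/seteqP; split=> p /=; [move/restrP|move=> h; apply/restrP].
apply: (@filter_bigI _ _ _ _ _ (@entourage_filter (config G A))) => g _.
exact: entourage_coordinate.
Qed.

Lemma nbhs_cylinder K x : nbhs x [set y | restr K x = restr K y].
Proof.
apply/nbhsP; exists [set p | restr K p.1 = restr K p.2].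
  exact: entourage_cylinder.
by move=> y /xsectionP.
Qed.

(** The cylinders around [x] form a filter base that converges to [x] in each coordinate, hence in
    the supremum topology. *)
Lemma cylinder_nbhs x (U : set (config G A)) : nbhs x U ->
  exists K, [set y | restr K x = restr K y] `<=` U.
Proof.
move=> xU; pose C K := [set y | restr K x = restr K y].
have FC : Filter (filter_from setT C).
  apply: filter_from_filter; first by exists fset0.
  move=> K L _ _; exists (K `|` L)%fset => // y /restrP xy.
  by split; apply/restrP => k kK; apply: xy; rewrite inE kK ?orbT.
have : filter_from setT C --> x.
  apply/cvg_sup => g B [_ [[V _ <-] Vx] VB].
  exists [fset g]%fset => // y /restrP xy; apply: VB.
  by move: Vx; rewrite /= /proj (xy g)// inE.
by move=> /(_ _ xU)[K _ ?]; exists K.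
Qed.

Lemma closed_cylinders (X : set (config G A)) :
  (forall x, (forall K, exists2 y, X y & restr K x = restr K y) -> X x) ->
  closed X.
Proof.
move=> h x clx; apply: h => K; have [y [Xy xy]] := clx _ (nbhs_cylinder K x).
by exists y.
Qed.

Lemma closed_missing_cylinder (X : set (config G A)) x : closed X -> ~ X x ->
  exists K, forall y, X y -> restr K x <> restr K y.
Proof.
move=> cX Xx; have /cylinder_nbhs[K KX] : nbhs x (~` X).
  by apply: open_nbhs_nbhs; split=> //; exact: closed_openC.
by exists K => y Xy /KX.
Qed.

End Cylinders.

(** * The shifts X(W, m): irreducibility and neighbourhoods *)

Section BoundedWindows.
Local Open Scope group_scope.
Variables (G : groupType) (A : finType) (a0 : A).
Implicit Types (x y : config G A) (W K F : {fset G}) (m : nat).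

Definition bounded_windows W m : set (config G A) :=
  [set x | forall g, (#|` [fset w in W | x (g * w)%g != a0]%fset| <= m)%N].

Lemma closed_bounded_windows W m : closed (bounded_windows W m).
Proof.
apply: closed_cylinders => x xX g.
have [y yX /restrP xy] := xX [fset g * w | w in W]%fset.
rewrite (_ : [fset w in W | _]%fset = [fset w in W | y (g * w) != a0]%fset)//.
apply/fsetP => w; rewrite !inE; case wW : (w \in W) => //=.
by rewrite xy//; apply/imfsetP; exists w.
Qed.

Lemma bounded_windows_invariant W m (g : G) x :
  bounded_windows W m x -> bounded_windows W m (translate g x).
Proof.
move=> xX h; have := xX (g^-1 * h); congr (_ <= _)%N; congr #|` _|.
by apply/fsetP => w; rewrite !inE /translate mulgA.
Qed.

Definition window_shift W m : shift_space G A :=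
  Shift (@closed_bounded_windows W m) (@bounded_windows_invariant W m).

Lemma bounded_windows_const W m : bounded_windows W m (fun=> a0).
Proof.
move=> g; rewrite (_ : [fset _ in _ | _]%fset = fset0) ?cardfs0//.
by apply/fsetP => w; rewrite !inE eqxx andbF.
Qed.

(** Copy [x] on [K] and [y] on [H], and write [a0] elsewhere. A window that meets [K] misses [H], so
    its symbols other than [a0] all come from [x], or else all from [y]. *)
Lemma window_shift_strongly_irreducible (S : {fset G}) W m :
  strongly_irreducible S (window_shift W m).
Proof.
(* The diameter of [W]: two points of one window are at most this far apart. *)
exists (\max_(w <- W) \max_(w' <- W) word_length S (w^-1 * w'))%N.
move=> K H KH x y xX yX.
pose z : config G A := fun g => if g \in K then x g else if g \in H then y g else a0.
have far k h w w' : k \in K -> h \in H -> w \in W -> w' \in W ->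
    k * w^-1 != h * w'^-1.
  move=> kK hH wW w'W; apply/eqP => e; have := KH _ _ kK hH.
  rewrite ltnNge => /negP; apply; rewrite /word_dist.
  have -> : k^-1 * h = w^-1 * w'.
    have -> : h = k * w^-1 * w' by rewrite e mulgVK.
    by rewrite -mulgA mulKg.
  pose L w w' := word_length S (w^-1 * w').
  apply: leq_trans (@leq_bigmax_seq _ (enum_fset W) xpredT (L w) w' w'W isT) _.
  exact: (@leq_bigmax_seq _ (enum_fset W) xpredT
    (fun w => \max_(w' <- W) L w w')%N w wW isT).
have zX : bounded_windows W m z.
  move=> g; have [[w wW gwK]|noK] := pselect (exists2 w, w \in W & g * w \in K).
    apply: leq_trans (xX g); apply: fsubset_leq_card; apply/fsubsetP => w'.
    rewrite !inE /z => /andP[w'W]; rewrite w'W /=.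
    case: ifP => // _; case: ifP => [gwH|]; last by rewrite eqxx.
    by have := far _ _ _ _ gwK gwH wW w'W; rewrite !mulgK eqxx.
  apply: leq_trans (yX g); apply: fsubset_leq_card; apply/fsubsetP => w'.
  rewrite !inE /z => /andP[w'W]; rewrite w'W /=.
  case: ifP => [gwK|_]; first by case: noK; exists w'.
  by case: ifP => [//|]; rewrite eqxx.
exists z; split=> //; apply/restrP => k kK; rewrite /z ?kK//.
(* [K] and [H] are disjoint, since a common point would be at distance 0. *)
case: ifP => // kK'; have := KH _ _ kK' kK; rewrite /word_dist mulVg.
by have /word_ballE := word_ball1 S 0; rewrite leqn0 => /eqP ->.
Qed.

(** By invariance, membership in X(W, m) is decided by the patterns over [W] alone, and close shifts
    have the same patterns over [W]. *)
Lemma window_shift_nbhs W m : exists2 V, nbhs (window_shift W m) V &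
  forall Y : shift_space G A, V Y -> Y `<=` window_shift W m.
Proof.
pose E := [set p : config G A * config G A | restr W p.1 = restr W p.2].
exists (xsection (hausdorff_rel E) (window_shift W m)).
  apply/nbhsP; exists (hausdorff_rel E) => //; exists E => //.
  exact: entourage_cylinder.
move=> Y /xsectionP[_ YX] y Yy g.
have [x xX /restrP /= xy] := YX _ (shift_invariant (g^-1) Yy).
have := xX 1; congr (_ <= _)%N; congr #|` _|.
apply/fsetP => w; rewrite !inE; case wW : (w \in W) => //=.
by rewrite mul1g xy// /translate invgK.
Qed.

End BoundedWindows.

(** * Entropy *)

Section Rate.
Variables (R : realType) (G : groupType) (A : finType) (S : {fset G}).
Hypothesis (genS : generates S).
Local Open Scope group_scope.
Implicit Types (X Y : shift_space G A) (F E K : {fset G}).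

Definition rate (X : set (config G A)) F : R := (ln (count X F)%:R / #|` F|%:R)%R.

Lemma pattern_entropyE (X : set (config G A)) F : (0 < count X F)%N ->
  pattern_entropy R X F = (rate X F)%:E.
Proof.
move=> cX; rewrite /pattern_entropy nval_fset_set lne_EFin ?ltr0n//.
by rewrite -EFinM mulrC.
Qed.

Lemma rate_ge0 (X : set (config G A)) F : (0 <= rate X F)%R.
Proof.
rewrite divr_ge0//; case: (count X F) => [|n]; first by rewrite ln0.
by rewrite ln_ge0// ler1n.
Qed.

Lemma count_shift X E (g : G) :
  (count X [fset (g * e)%g | e in E]%fset <= count X E)%N.
Proof.
apply: (nval_le (h := translate g^-1)) => [x|x y _ _ /restrP xy].
  exact: shift_invariant.
apply/restrP => _ /imfsetP[e eE ->].
by have := xy e eE; rewrite /translate invgK.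
Qed.

(** Apply [shearer] to the translates of [E] that meet [F]: a point [v] of [F] lies in exactly [|E|]
    of them, those based at [v * e^-1]. *)
Lemma shearer_shift X E F : E != fset0 ->
  (count X F ^ #|` E| <= count X E ^ #|` [fset (f * e^-1)%g | f in F, e in E]%fset|)%N.
Proof.
move=> E0; set I := [fset _ | _ in _, _ in _]%fset.
have E_gt0 : (0 < #|` E|)%N by rewrite cardfs_gt0.
have sh := @shearer G A R I (fun i => [fset (val i * e)%g | e in E]%fset)
  #|` E| F X E_gt0.
apply: leq_trans (sh _) _; last first.
  rewrite cardfE -prod_nat_const; apply: leq_prod => i _; exact: count_shift.
move=> v vF.
pose ix (e : E) : I := [` in_imfset2 imfset_key (fun f e => f * e^-1) vF (valP e)].
have -> : [set i : I | v \in [fset (val i * e)%g | e in E]%fset]%SET =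
    (ix @: [set: E])%SET.
  apply/setP => i; rewrite inE; apply/imfsetP/imsetP => [[e eE ve]|[e _ ->]].
    by exists [` eE] => //; apply: val_inj; rewrite /= ve mulgK.
  by exists (val e); rewrite ?mulgVK//=; exact: valP.
rewrite card_imset ?cardsT ?cardfE// => e e' /(congr1 val) /= /mulgI /invg_inj.
exact: val_inj.
Qed.

Lemma rate_le X E F r : (exists x, shift_set X x) -> E != fset0 -> F != fset0 ->
  (forall e, e \in E -> word_ball S r e) ->
  (rate X F <= (1 + boundary_ratio S R r F) * rate X E)%R.
Proof.
move=> [x Xx] E0 F0 Er.
have cX K : (0 < count X K)%N by exact: nval_gt0 Xx.
have E_gt0 : (0 < #|` E|%:R :> R)%R by rewrite ltr0n cardfs_gt0.
have F_gt0 : (0 < #|` F|%:R :> R)%R by rewrite ltr0n cardfs_gt0.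
have lnE0 : (0 <= ln (count X E)%:R :> R)%R by rewrite ln_ge0// ler1n.
have sh : (#|` E|%:R * ln (count X F)%:R <=
    (#|` F|%:R + #|` fset_set (boundary S r F)|%:R) * ln (count X E)%:R :> R)%R.
  apply: (@le_trans _ _ (ln ((count X E ^
      #|` [fset (f * e^-1)%g | f in F, e in E]%fset|)%N%:R))).
    rewrite mulr_natl -lnXn ?ltr0n// ler_ln ?posrE ?exprn_gt0 ?ltr0n ?expn_gt0 ?cX//.
    by rewrite -natrX ler_nat shearer_shift.
  rewrite natrX lnXn ?ltr0n// -[leLHS]mulr_natl ler_wpM2r// -natrD ler_nat.
  exact: card_boundary_out.
rewrite /rate /boundary_ratio ler_pdivrMr// mulrAC mulrDl mul1r divfK ?gt_eqF//.
by rewrite mulrA ler_pdivlMr// mulrC.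
Qed.

Definition inf_rate (X : set (config G A)) : R :=
  inf [set rate X E | E in [set E | E != fset0]].

Lemma inf_rate_le (X : set (config G A)) F : F != fset0 -> (inf_rate X <= rate X F)%R.
Proof.
move=> F0; apply: ge_inf; last by exists F.
by exists 0%R => _ [E _ <-]; exact: rate_ge0.
Qed.

Lemma le_inf_rate (X : set (config G A)) (c : R) : (forall F, F != fset0 -> (c <= rate X F)%R) ->
  (c <= inf_rate X)%R.
Proof.
move=> h; apply: lb_le_inf; last by move=> _ [E E0 <-]; exact: h.
by exists (rate X [fset 1]); exists [fset 1] => //=; rewrite -cardfs_gt0 cardfs1.
Qed.

Lemma rate_cvg X (F : nat -> {fset G}) : (exists x, shift_set X x) -> Folner S R F ->
  rate X (F n) @[n --> \oo] --> inf_rate X.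
Proof.
move=> X0 [F0 Fcvg]; apply/cvgrPdist_le => /= e e0.
have [E E0 rE] : exists2 E : {fset G}, E != fset0 & (rate X E < inf_rate X + e / 2)%R.
  apply: contrapT => no; have : (inf_rate X + e / 2 <= inf_rate X)%R.
    apply: le_inf_rate => E E0; rewrite leNgt; apply/negP => ?.
    by apply: no; exists E.
  lra.
have [r Er] := sub_word_ball S E.
(* The [+ 1] keeps the denominator positive when [rate X E] is 0. *)
have d0 : (0 < e / 2 / (rate X E + 1))%R.
  by rewrite !divr_gt0// ltr_wpDl// rate_ge0.
have := Fcvg r; move/cvgr0Pnorm_le => /(_ _ d0); apply: filterS => n.
rewrite ger0_norm ?divr_ge0// => rho.
have := inf_rate_le X (F0 n); have := rate_le X0 E0 (F0 n) Er.
have : (boundary_ratio S R r (F n) * rate X E <= e / 2)%R.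
  move: rho; rewrite ler_pdivlMr; last by rewrite ltr_wpDl// rate_ge0.
  have : (0 <= boundary_ratio S R r (F n))%R by rewrite divr_ge0.
  have := rate_ge0 X E; nra.
rewrite ler_norml; lra.
Qed.

(** Amenability supplies one Følner sequence, along which limits are unique; this pins down the
    value chosen by [get]. *)
Lemma entropyE X : amenable S R -> (exists x, shift_set X x) ->
  entropy R S X = (inf_rate X)%:E.
Proof.
move=> [F FF] X0; have [x Xx] := X0.
have cvgX (F' : nat -> {fset G}) : Folner S R F' ->
    pattern_entropy R X (F' n) @[n --> \oo] --> (inf_rate X)%:E.
  move=> FF'; under eq_fun do rewrite pattern_entropyE ?(nval_gt0 _ Xx)//.
  by apply: cvg_EFin; [exact: nearW|exact: rate_cvg].
rewrite /entropy; case: xgetP => [h _ hP|/(_ (inf_rate X)%:E)//].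
apply: (@cvg_unique _ (@ereal_hausdorff R) _ _ _ _ (hP _ FF) (cvgX _ FF)).
Qed.

End Rate.

(** * Entropy drop for proper subshifts *)

Section EntropyMinimality.
Variables (R : realType) (G : groupType) (A : finType) (S : {fset G}).
Hypothesis (genS : generates S).
Local Open Scope group_scope.
Implicit Types (X Y : shift_space G A) (F K : {fset G}) (x y : config G A).

Section Avoid.
Variables (X : shift_space G A) (r : nat).
Hypothesis irrX : forall K H : {fset G},
  (forall k h, k \in K -> h \in H -> (r < word_dist S k h)%N) ->
  forall x y, shift_set X x -> shift_set X y ->
  exists z, [/\ shift_set X z, restr K z = restr K x & restr H z = restr H y].
Variables (K F : {fset G}) (x0 : config G A).
Hypothesis Xx0 : shift_set X x0.

Let B := fset_set (word_ball S r).
Let KB := [fset k * b | k in K, b in B]%fset.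

(** If [g'] is outside [g Z], with [Z] this set, then [g' K] misses [g KB]: changes made inside
    [g KB] do not affect the pattern at [g']. The point 1 makes each greedy pick remove itself. *)
Definition exclusion_zone : {fset G} :=
  (1 |` [fset kb * k^-1 | kb in KB, k in K])%fset.

Definition avoiding (s : seq G) : set (config G A) :=
  [set x | shift_set X x /\
    forall g, g \in s -> restr K (translate g^-1 x) <> restr K x0].

(** Each further point [g] to avoid multiplies the count by at most [1 - 1 / M], where [M] bounds
    the number of patterns on [g KB]. The head of the list is treated last, when the points after it
    are known to be separated from it. *)
Lemma count_avoiding s :
  (forall g, g \in s -> forall k, k \in K -> g * k \in F) ->
  pairwise (fun g g' => g' \notin [fset g * z | z in exclusion_zone]%fset) s ->
  ((#|A| ^ #|` KB|) ^ size s * count (avoiding s) F <=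
   (#|A| ^ #|` KB|).-1 ^ size s * count X F)%N.
Proof.
set M := (_ ^ #|` KB|)%N.
elim: s => [_ _|g s IHs sF /= /andP[/allP gs ps]].
  by rewrite !expn0 !mul1n; apply: count_le => // x [].
have gF k : k \in K -> g * k \in F by apply: sF; rewrite mem_head.
have {}sF g' : g' \in s -> forall k, k \in K -> g' * k \in F.
  by move=> g's; apply: sF; rewrite in_cons g's orbT.
have M0 : (0 < M)%N by rewrite expn_gt0; apply/orP; left; apply/card_gt0P; exists (x0 1).
pose hits x := restr K (translate g^-1 x) == restr K x0.
pose N1 := count (avoiding s `&` [set x | hits x = false]) F.
pose N2 := count (avoiding s `&` [set x | hits x = true]) F.
have split : count (avoiding s) F = (N2 + N1)%N.
  rewrite /count (@nval_split _ _ _ _ _ hits) ?big_bool//.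
  move=> x y _ _ /restrP xy; rewrite /hits; congr (_ == _); apply/restrP => k kK.
  by rewrite /translate invgK xy// gF.
have N1E : (count (avoiding (g :: s)) F <= N1)%N.
  apply: count_le => // x [Xx xg]; split; last first.
    by apply/negbTE/eqP; apply: xg; rewrite mem_head.
  by split=> // g' g's; apply: xg; rewrite in_cons g's orbT.
(* Strong irreducibility glues the forbidden pattern on [g K] to [x] on [F] minus [g KB]; every
   point within [r] of [g K] lies in [g KB]. *)
have repl x : avoiding s x -> exists z, [/\ avoiding s z, hits z &
    forall h, h \in F -> h \notin [fset g * kb | kb in KB]%fset -> z h = x h].
  move=> [Xx xs]; pose H := (F `\` [fset g * kb | kb in KB])%fset.
  have [|z [Xz /restrP zK /restrP zH]] := @irrX [fset g * k | k in K]%fset H _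
      (translate g x0) x (shift_invariant g Xx0) Xx.
    move=> _ h /imfsetP[k /= kK ->]; rewrite inE => /andP[hKB hF].
    rewrite ltnNge; apply/negP => hr; case/negP: hKB.
    apply/imfsetP; exists (k * ((g * k)^-1 * h)); last by rewrite !mulgA mulgV mul1g.
    apply/imfset2P; exists k => //; exists ((g * k)^-1 * h) => //.
    rewrite in_fset_set; last exact: finite_word_ball.
    by rewrite inE; apply/word_ballE.
  exists z; split; last by move=> h hF hKB; apply: zH; rewrite inE hKB.
    (* If [g' * k] were in [g KB], then [g'] would be in [g Z], against the separation. *)
    split=> // g' g's; have := xs _ g's; congr (_ <> _); apply/restrP => k kK.
    rewrite /translate invgK zH// inE sF// andbT; apply/imfsetP => -[kb /= kbKB e].
    have := gs _ g's; case/negP; apply/imfsetP; exists (kb * k^-1).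
      by apply/fset1Ur/imfset2P; exists kb => //; exists k.
    by rewrite mulgA -e mulgK.
  apply/eqP/restrP => k kK; rewrite {1}/translate invgK zK ?/translate ?mulKg//.
  by apply/imfsetP; exists k.
(* Rewriting [x] near [g] so that it hits the pattern there is at most
   [M]-to-one on patterns over [F]. *)
have N2E : (count (avoiding s) F <= N2 * M)%N.
  pose f x := if pselect (avoiding s x) is left p then sval (cid (repl x p)) else x.
  have fP x : avoiding s x -> [/\ avoiding s (f x), hits (f x) &
    forall h, h \in F -> h \notin [fset g * kb | kb in KB]%fset -> f x h = x h].
    by rewrite /f; case: pselect => // p _; exact: svalP (cid (repl x p)).
  pose gKB := [fset g * kb | kb in KB]%fset.
  have gKBM : (#|{ffun gKB -> A}| <= M)%N.
    rewrite card_pattern /M leq_pexp2l//; first by apply/card_gt0P; exists (x0 1).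
    exact: leq_imfset_card.
  apply: (@leq_trans (nval (avoiding s) (fun x => (restr F (f x), restr gKB x)))).
    apply: (nval_le (h := id)) => // x y xs ys [/restrP exy /restrP xy].
    apply/restrP => h hF; have [/xy//|hKB] := boolP (h \in gKB).
    by have [_ _ <-//] := fP _ xs; have [_ _ <-//] := fP _ ys; exact: exy.
  apply: leq_trans (nval_pair _ _ _) _.
  apply: leq_mul (leq_trans (max_card _) gKBM).
  by apply: (nval_le (h := f)) => // x /fP[].
(* A rearrangement of [N1 + N2 <= N2 * M]. *)
have step : (M * N1 <= M.-1 * count (avoiding s) F)%N.
  move: N2E; rewrite split mulnDr; case: (M) M0 => // M' _ /=; nia.
have {}IHs := IHs sF ps.
rewrite /= !expnS -!mulnA [leqLHS]mulnCA.
apply: (@leq_trans (M ^ size s * (M * N1))%N).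
  by rewrite !leq_mul2l N1E !orbT.
apply: (@leq_trans (M ^ size s * (M.-1 * count (avoiding s) F))%N).
  by rewrite leq_mul2l step orbT.
by rewrite mulnCA leq_mul2l IHs orbT.
Qed.

End Avoid.

Lemma entropy_empty Y : amenable S R -> ~ (exists y, shift_set Y y) ->
  entropy R S Y = -oo%E.
Proof.
move=> [F FF] Y0.
have Y0E : shift_set Y = set0 by apply/eqP/negPn/negP => /set0P.
have e K : K != fset0 -> pattern_entropy R Y K = -oo%E.
  move=> K0; rewrite /pattern_entropy nval_fset_set nval_eq0// /lne lexx gt0_muleNy//.
  by rewrite lte_fin invr_gt0 ltr0n cardfs_gt0.
have cvgY (F' : nat -> {fset G}) : Folner S R F' ->
    pattern_entropy R Y (F' n) @[n --> \oo] --> -oo%E.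
  by move=> [F0 _]; under eq_fun do rewrite e//; exact: cvg_cst.
rewrite /entropy; case: xgetP => [h _ hP|/(_ -oo%E)//].
exact: (cvg_unique (@ereal_hausdorff R) (hP _ FF) (cvgY _ FF)).
Qed.

Lemma entropy_drop X Y : amenable S R -> strongly_irreducible S X ->
  Y `<=` X -> (exists x, shift_set X x /\ ~ shift_set Y x) ->
  (0 < inf_rate R X)%R -> ~ ((inf_rate R X)%:E <= entropy R S Y)%E.
Proof.
move=> amenG [r irrX] YX [x0 [Xx0 Yx0]] c0.
have [K missK] := closed_missing_cylinder (@shift_closed _ _ Y) Yx0.
have [r' Kr'] := sub_word_ball S K; have [F FF] := amenG.
have [[y0 Yy0]|Y0] := pselect (exists y, shift_set Y y); last first.
  by rewrite (entropy_empty amenG Y0).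
(* Without a limit for [Y], [entropy R S Y] is the default value [0]. *)
rewrite /entropy; case: xgetP => [h _ hP|_]; last by rewrite lee_fin leNgt c0.
pose Z := exclusion_zone r K.
pose M := (#|A| ^ #|` [fset (k * b)%g | k in K, b in fset_set (word_ball S r)]%fset|)%N.
have cX n : (0 < count X (F n))%N by exact: nval_gt0 Xx0.
have cY n : (0 < count Y (F n))%N by exact: nval_gt0 Yy0.
have M0 : (0 < M)%N by rewrite expn_gt0; apply/orP; left; apply/card_gt0P; exists (x0 1).
have Z0 : (0 < #|` Z|)%N by rewrite cardfs_gt0; apply/fset0Pn; exists 1; exact: fset1U1.
(* About [|F n| / |Z|] separated points fit into [F n], up to the boundary, and each lowers the
   logarithm of the count by at least [1 / M]. *)
pose d : R := ((M%:R * #|` Z|%:R)^-1)%R.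
have d0 : (0 < d)%R by rewrite invr_gt0 mulr_gt0// ltr0n.
have rateY n : (rate R Y (F n) <= rate R X (F n) - (1 - boundary_ratio S R r' (F n)) * d)%R.
  pose F0 := [fset g in F n | all (fun k => (g * k)%g \in F n) K]%fset.
  have [s [sF0 ps cs]] := separated_subset F0 (fset1U1 _ _ : 1 \in Z).
  have sF g : g \in s -> forall k, k \in K -> g * k \in F n.
    by move=> /sF0; rewrite !inE => /andP[_ /allP].
  have := count_avoiding irrX Xx0 sF ps; rewrite -/M => cA.
  have {}cA : (M ^ size s * count Y (F n) <= M.-1 ^ size s * count X (F n))%N.
    apply: leq_trans cA; rewrite leq_mul2l; apply/orP; right.
    apply: count_le => // y Yy; split; first exact: YX.
    by move=> g _ e; apply: (missK _ (shift_invariant g^-1 Yy)); rewrite e.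
  have N0 : (0 < #|` F n|%:R :> R)%R by rewrite ltr0n cardfs_gt0; apply FF.1.
  have MR : (0 < M%:R :> R)%R by rewrite ltr0n.
  have ZR : (0 < #|` Z|%:R :> R)%R by rewrite ltr0n.
  have lnY : (ln (count Y (F n))%:R <= ln (count X (F n))%:R - (size s)%:R / M%:R :> R)%R.
    have Ms : (0 < M%:R ^+ size s :> R)%R by rewrite exprn_gt0.
    (* The inequality [1 - 1 / M <= exp (- 1 / M)], raised to the power [size s]. *)
    have hM : (M.-1%:R ^+ size s <= M%:R ^+ size s * expR (- ((size s)%:R / M%:R)) :> R)%R.
      rewrite -mulrN mulrC expRM_natl -exprMn mulrC; apply: lerXn2r.
      - by rewrite nnegrE.
      - by rewrite nnegrE mulr_ge0// expR_ge0.
      have := ler_wpM2l (ltW MR) (expR_ge1Dx (- M%:R^-1 : R)); rewrite mulrDr mulr1 mulrN.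
      by rewrite divff ?gt_eqF// -{1}(prednK M0) -natr1 addrK mulrC.
    have : (M%:R ^+ size s * (count Y (F n))%:R <=
        M%:R ^+ size s * (expR (- ((size s)%:R / M%:R)) * (count X (F n))%:R) :> R)%R.
      rewrite mulrA; apply: le_trans (ler_wpM2r (ler0n _ _) hM).
      by rewrite -!natrX -!natrM ler_nat.
    rewrite ler_pM2l// => h1.
    have : (ln (count Y (F n))%:R <=
        ln (expR (- ((size s)%:R / M%:R)) * (count X (F n))%:R) :> R)%R.
      by rewrite ler_ln ?posrE ?mulr_gt0 ?expR_gt0 ?ltr0n.
    by rewrite lnM ?posrE ?expR_gt0 ?ltr0n// expRK addrC.
  have csR : (#|` F n|%:R - #|` fset_set (boundary S r' (F n))|%:R <=
      #|` Z|%:R * (size s)%:R :> R)%R.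
    rewrite lerBlDr -natrM -natrD ler_nat.
    apply: leq_trans (card_boundary_in genS (F n) Kr') _.
    by rewrite leq_add2r.
  have : ((1 - boundary_ratio S R r' (F n)) * d <= (size s)%:R / M%:R / #|` F n|%:R)%R.
    rewrite /boundary_ratio /d; set N := (#|` F n|%:R)%R; set b := (_%:R / N)%R.
    have -> : ((1 - b) * (M%:R * #|` Z|%:R)^-1 = (N - b * N) / #|` Z|%:R / M%:R / N)%R.
      by field; rewrite !gt_eqF.
    rewrite !ler_pM2r ?invr_gt0// ler_pdivrMr// [leRHS]mulrC /b divfK ?gt_eqF//.
  rewrite /rate; move: lnY; rewrite -(ler_pM2r (_ : 0 < #|` F n|%:R^-1)%R) ?invr_gt0// mulrBl.
  lra.
have lim : (rate R X (F n) - (1 - boundary_ratio S R r' (F n)) * d)%R @[n --> \oo] -->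
    (inf_rate R X - (1 - 0) * d)%R.
  apply: cvgB; first by apply: rate_cvg => //; exists x0.
  apply: cvgM; last exact: cvg_cst.
  by apply: cvgB; [exact: cvg_cst|exact: FF.2].
have limE : (rate R X (F n) - (1 - boundary_ratio S R r' (F n)) * d)%R%:E @[n --> \oo] -->
    (inf_rate R X - (1 - 0) * d)%R%:E.
  by apply: cvg_EFin; [exact: nearW|exact: lim].
have : (h <= (inf_rate R X - (1 - 0) * d)%R%:E)%E.
  apply: (lee_cvg_to (hP _ FF) limE); apply: nearW => n.
  by rewrite pattern_entropyE// lee_fin.
move=> hd /le_trans/(_ hd); rewrite lee_fin.
lra.
Qed.

End EntropyMinimality.

(** * Density of the entropies *)

Section WindowCounting.
Local Open Scope group_scope.
Variables (G : groupType) (A : finType) (a0 : A).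
Variables (W F : {fset G}) (J : nat).
Hypotheses (J_gt0 : (0 < J)%N) (cardW : #|` W| = (J ^ 4)%N).
Implicit Types (x y : config G A) (V M : {fset G}) (g v : G).

Let meets g v := g^-1 * v \in W.
Let windows : {fset G} := [fset (f * w^-1)%g | f in F, w in W]%fset.
Let supp x : {fset G} := [fset f in F | x f != a0]%fset.

Let cardV V g : #|` [fset v in V | meets g v]%fset| =
  #|` [fset w in W | g * w \in V]%fset|.
Proof.
have <- : #|` [fset g * w | w in [fset w in W | g * w \in V]]%fset| =
    #|` [fset w in W | g * w \in V]%fset|.
  by rewrite card_imfset//; exact: mulgI.
congr #|` _|; apply/fsetP => v.
rewrite !inE; apply/idP/imfsetP => [/andP[vV gv]|[w /=]].
  by exists (g^-1 * v); rewrite ?mulVKg// !inE [_ \in W]gv mulVKg.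
by rewrite !inE => /andP[wW gwV] ->; rewrite gwV /meets mulKg.
Qed.

Let supp_window x g :
  ([fset w in W | g * w \in supp x] `<=` [fset w in W | x (g * w) != a0])%fset.
Proof. by apply/fsubsetP => w; rewrite !inE => /and3P[-> _ ->]. Qed.

(* [hitting_set] with [q = J ^ 2], so that [q m >= J ^ 5]. *)
Lemma sparse_hitting_set (m : nat) x : (J ^ 3 <= m.+1)%N -> bounded_windows a0 W m.+1 x ->
  exists M : {fset G}, (J * #|` M| <= 2 * #|` F|)%N /\
    bounded_windows a0 W m (fun g => if g \in (supp x `\` M)%fset then x g else a0).
Proof.
move=> Jm xX; pose V := supp x.
pose D := [fset g in windows | m.+1 <= #|` [fset v in V | meets g v]|]%fset.
have [||d|M [MV hit cM]] := @hitting_set G G V meets m.+1 (J ^ 2) _ _ D.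
- by [].
- by rewrite expn_gt0 J_gt0.
- by rewrite !inE => /andP[].
exists M; split.
  (* Double counting: a window in [D] has at least [m.+1] points of [V], and a point lies in at most
     [J ^ 4] windows. *)
  have cD : (m.+1 * #|` D| <= #|` V| * J ^ 4)%N.
    rewrite -sum_const_fset.
    apply: (@leq_trans (\sum_(d <- D) #|` [fset v in V | meets d v]%fset|)%N).
      by rewrite big_seq [leqRHS]big_seq; apply: leq_sum => d; rewrite !inE => /andP[].
    rewrite double_counting mulnC -sum_const_fset; apply: leq_sum => v _.
    rewrite -cardW; apply: (@leq_trans #|` [fset v * w^-1 | w in W]%fset|); last first.
      exact: leq_imfset_card.
    apply/fsubset_leq_card/fsubsetP => d; rewrite !inE => /andP[_ dv].
    by apply/imfsetP; exists (d^-1 * v) => //; rewrite invgM invgK mulVKg.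
  have VF : (#|` V| <= #|` F|)%N.
    by apply/fsubset_leq_card/fsubsetP => v; rewrite !inE => /andP[].
  have J5 : (J ^ 5 <= J ^ 2 * m.+1)%N by rewrite (expnD J 2 3) leq_mul2l Jm orbT.
  have J4 : (0 < J ^ 4)%N by rewrite expn_gt0 J_gt0.
  rewrite -(leq_pmul2l J4) mulnA -expnSr.
  apply: (@leq_trans (J ^ 2 * m.+1 * #|` M|)%N); first by rewrite leq_mul2r J5 orbT.
  apply: leq_trans cM _; rewrite -expnM; move: cD VF J4; nia.
(* A window outside [D] keeps at most its [m] points of [V]. A window in [D] meets [M], and erasing
   that point lowers its count below [m.+1]. *)
move=> g; case: (leqP m.+1 #|` [fset v in V | meets g v]%fset|) => [gD|gV]; last first.
  rewrite -ltnS; apply: leq_ltn_trans gV; rewrite cardV; apply: fsubset_leq_card.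
  apply/fsubsetP => w; rewrite !inE => /andP[-> /=].
  by case: ifP => [/andP[_ ->]//|]; rewrite eqxx.
have [|v vM gv] := hit g.
  rewrite !inE gD andbT; move: (gD); rewrite cardV => /(leq_trans (ltn0Sn m)).
  rewrite cardfs_gt0 => /fset0Pn[w]; rewrite !inE => /and3P[wW gwF _].
  by apply/imfset2P; exists (g * w) => //; exists w; rewrite ?mulgK.
rewrite -ltnS; apply: leq_trans (xX g); apply: fproper_ltn_card.
rewrite fproperE; apply/andP; split.
  apply/fsubsetP => w; rewrite !inE => /andP[-> /=].
  by case: ifP => [/andP[_ /andP[_ ->]]//|]; rewrite eqxx.
have vV := fsubsetP MV _ vM.
apply/fsubsetPn; exists (g^-1 * v); rewrite !inE [_ \in W]gv mulVKg ?vM /= ?eqxx//.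
by move: vV; rewrite !inE => /andP[].
Qed.

Lemma card_pattern_support x M : {in F, forall g, x g != a0 -> g \in M} ->
  (#|[pred k : F | restr F x k != a0]| <= #|` M|)%N.
Proof.
move=> xM; have <- : #|` [fset val k | k in [pred k : F | restr F x k != a0]]%fset| =
    #|[pred k : F | restr F x k != a0]|.
  by rewrite (card_imfset _ _ val_inj) cardE.
apply/fsubset_leq_card/fsubsetP => g /imfsetP[k /= kx ->].
apply: xM; first exact: valP. by move: kx; rewrite unfold_in /= ffunE.
Qed.

(** On [F], [x] is recovered from [rest x], which lies in X(W, m), and from [part x], the symbols on
    the hitting set, which form a sparse pattern. *)
Lemma count_window_step m : (J ^ 3 <= m.+1)%N ->
  (count (bounded_windows a0 W m.+1) F <=
   count (bounded_windows a0 W m) F * #|@sparse A a0 F J|)%N.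
Proof.
move=> Jm; set X := bounded_windows _ _ _.
pose Mof x : {fset G} := if pselect (X x) is left p
  then sval (cid (sparse_hitting_set Jm p)) else fset0.
pose rest x : config G A := fun g => if g \in (supp x `\` Mof x)%fset then x g else a0.
pose part x : config G A := fun g => if g \in Mof x then x g else a0.
have MofP x : X x -> (J * #|` Mof x| <= 2 * #|` F|)%N /\ bounded_windows a0 W m (rest x).
  by rewrite /rest /Mof; case: pselect => // p _; exact: svalP (cid (sparse_hitting_set Jm p)).
apply: (@leq_trans (nval X (fun x => (restr F (rest x), restr F (part x))))).
  apply: (nval_le (h := id)) => // x y _ _ [/restrP exy /restrP pxy].
  apply/restrP => g gF.
  have split z : z g = if rest z g == a0 then part z g else rest z g.
    rewrite /rest /part !inE gF /=.
    have [gM|gM] := boolP (g \in Mof z); first by rewrite eqxx.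
    by have [->|zg] := eqVneq (z g) a0; rewrite /= ?eqxx// (negbTE zg).
  by rewrite split [RHS]split exy// pxy.
apply: leq_trans (nval_pair _ _ _) _; apply: leq_mul.
  by apply: (nval_le (h := rest)) => // x /MofP[].
apply/subset_leq_card/fintype.subsetP => p /asboolP[x /MofP[JM _] <-].
rewrite inE -cardfE; apply: leq_trans JM; rewrite leq_mul2l; apply/orP; right.
apply: card_pattern_support => g _; rewrite /part.
by case: ifP => //; rewrite eqxx.
Qed.

(** Double counting: each point of the support lies in [J ^ 4] windows, each window holds at most
    [J ^ 3] such points, and at most [2 |F|] windows meet [F]. *)
Lemma count_window_bottom : (#|` windows| <= 2 * #|` F|)%N ->
  (count (bounded_windows a0 W (J ^ 3)) F <= #|@sparse A a0 F J|)%N.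
Proof.
move=> win; apply/subset_leq_card/fintype.subsetP => p /asboolP[x xX <-].
rewrite inE -cardfE.
have xV : (#|[pred k : F | restr F x k != a0]| <= #|` supp x|)%N.
  by apply: card_pattern_support => g gF xg; rewrite !inE gF.
apply: (@leq_trans (J * #|` supp x|)%N); first by rewrite leq_mul2l xV orbT.
have J3 : (0 < J ^ 3)%N by rewrite expn_gt0 J_gt0.
rewrite -(leq_pmul2l J3) mulnA -expnSr -cardW -sum_const_fset.
apply: (@leq_trans (J ^ 3 * #|` windows|)%N); last by rewrite leq_mul2l win orbT.
rewrite -sum_const_fset.
apply: (@leq_trans (\sum_(g <- windows) #|` [fset v in supp x | meets g v]%fset|)%N).
  rewrite double_counting big_seq [leqRHS]big_seq; apply: leq_sum => v vV.
  have vF : v \in F by move: vV; rewrite !inE => /andP[].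
  have <- : #|` [fset v * w^-1 | w in W]%fset| = #|` W|.
    by rewrite card_imfset// => w w' /mulgI /invg_inj.
  apply/fsubset_leq_card/fsubsetP => g /imfsetP[w /= wW ->].
  rewrite !inE /meets invgM invgK mulgVK wW andbT.
  by apply/imfset2P; exists v => //; exists w.
apply: leq_sum => g _; rewrite cardV.
exact: leq_trans (fsubset_leq_card (supp_window x g)) (xX g).
Qed.

End WindowCounting.

(** * Isolation, and entropies of the shifts X(W, m) *)

Section Density.
Variables (R : realType) (G : groupType) (A : finType) (a0 : A) (S : {fset G}).
Hypothesis (genS : generates S) (amenG : amenable S R).
Implicit Types (X Y : shift_space G A) (W F : {fset G}).

Lemma shift_space_inj X Y : shift_set X = shift_set Y -> X = Y.
Proof.
case: X Y => [X cX iX] [Y cY iY] /= e; case: _ / e in cY iY *.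
by rewrite (Prop_irrelevance cX cY) (Prop_irrelevance iX iY).
Qed.

Lemma isolated_strongly_irreducible X (c : R) V :
  strongly_irreducible S X -> (0 < c)%R -> entropy R S X = c%:E ->
  (exists x, shift_set X x) ->
  nbhs X V -> (forall Y, V Y -> Y `<=` X) -> isolated (shifts_ge S A c) X.
Proof.
move=> irrX c0 entX X0 XV VX; split; first by rewrite inE /shifts_ge /= entX.
exists V => //; apply/seteqP; split=> [Y [VY Yc]|_ ->]; last first.
  by split; [exact: nbhs_singleton|rewrite /shifts_ge /= entX].
apply: shift_space_inj; apply/seteqP; split; first exact: VX.
move: entX; rewrite entropyE// => -[infE].
apply: contrapT => YX; apply: (entropy_drop (Y := Y) genS amenG irrX (VX Y VY)).
- by apply: contrapT => no; apply: YX => x Xx; apply: contrapT => Yx; apply: no; exists x.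
- by rewrite infE.
- by rewrite infE.
Qed.

Lemma rate_max (X : set (config G A)) F : F != fset0 -> (rate R X F <= ln #|A|%:R)%R.
Proof.
move=> F0; have A0 : (0 < #|A|)%N by apply/card_gt0P; exists a0.
have lnA : (0 <= ln #|A|%:R :> R)%R by rewrite ln_ge0// ler1n.
rewrite ler_pdivrMr ?ltr0n ?cardfs_gt0//.
have := count_max X F; case: (count X F) => [|n] cX.
  by rewrite ln0// mulr_ge0.
rewrite mulr_natr -lnXn ?ltr0n// ler_ln ?posrE ?exprn_gt0 ?ltr0n//.
by rewrite -natrX ler_nat.
Qed.

Lemma inf_rate_max (X : set (config G A)) : (inf_rate R X <= ln #|A|%:R)%R.
Proof.
have F1 : [fset 1%g : G]%fset != fset0 by rewrite -cardfs_gt0 cardfs1.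
exact: le_trans (inf_rate_le _ _ F1) (rate_max _ F1).
Qed.

Lemma window_rate_full W F : F != fset0 ->
  rate R (bounded_windows a0 W #|` W|) F = ln #|A|%:R.
Proof.
move=> F0; have A0 : (0 < #|A|)%N by apply/card_gt0P; exists a0.
rewrite /rate (_ : count _ _ = #|A| ^ #|` F|)%N; last first.
  rewrite -card_pattern; apply: eq_card => p; rewrite !inE; apply/asboolP.
  exists (fun g => if insub g is Some k then p k else a0); last first.
    by apply/ffunP => k; rewrite ffunE valK.
  by move=> g; apply/fsubset_leq_card/fsubsetP => w; rewrite !inE => /andP[].
by rewrite natrX lnXn ?ltr0n// -[X in (X / _)%R]mulr_natr mulfK// pnatr_eq0 cardfs_eq0.
Qed.

Lemma window_entropies_dense (t e : R) : ([set: G] #= [set: nat])%card ->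
  (0 < t <= ln #|A|%:R)%R -> (0 < e)%R ->
  exists W m, (t <= inf_rate R (window_shift a0 W m) <= t + e)%R.
Proof.
move=> countG /andP[t0 tA] e0.
have [J [J0 sparseJ]] := card_sparse a0 e0.
have [W cardW] : exists W : {fset G}, #|` W| = (J ^ 4)%N.
  have infG : infinite_set [set: G].
    by apply/infiniteP; move: countG; rewrite card_eq_le => /andP[].
  have [B _ cB] := infinite_set_fset (J ^ 4) infG.
  exists [fset g in take (J ^ 4) (enum_fset B)]%fset.
  by rewrite card_fseq undup_id ?take_uniq// size_takel.
pose h m := inf_rate R (window_shift a0 W m).
have pos m F : (0 < count (window_shift a0 W m) F)%N.
  exact: (nval_gt0 _ (bounded_windows_const a0 W m)).
have bottom : (h (J ^ 3)%N <= e)%R.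
  (* A single Følner set with boundary ratio at most 1 is enough: at most [2 |F|] windows meet
     it. *)
  have [F [F0 Fcvg]] := amenG.
  have [r Wr] := sub_word_ball S W.
  have := Fcvg r; move/cvgr0Pnorm_le => /(_ 1%R ltr01)[n _ /(_ n (leqnn n))].
  rewrite /= ger0_norm ?divr_ge0// ler_pdivrMr ?ltr0n ?cardfs_gt0// mul1r ler_nat => bd.
  apply: le_trans (inf_rate_le _ _ (F0 n)) _.
  rewrite /rate ler_pdivrMr ?ltr0n ?cardfs_gt0//.
  rewrite [X in (_ * X%:R)%R]cardfE; apply: le_trans (sparseJ (F n)).
  have cb := count_window_bottom a0 J0 cardW (F := F n).
  have le_sparse : (count (window_shift a0 W (J ^ 3)) (F n) <= #|@sparse A a0 (F n) J|)%N.
    by apply: cb; apply: leq_trans (card_boundary_out genS _ Wr) _; lia.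
  by rewrite ler_ln ?posrE ?ltr0n ?ler_nat// (leq_trans (pos _ _) le_sparse).
have step m : (J ^ 3 <= m.+1)%N -> (h m.+1 <= h m + e)%R.
  (* The bound holds for every finite [F], so it passes to the infimum without a Følner sequence. *)
  move=> Jm; rewrite -lerBlDr; apply: le_inf_rate => F F0; rewrite lerBlDr.
  apply: le_trans (inf_rate_le _ _ F0) _.
  have F0R : (0 < #|` F|%:R :> R)%R by rewrite ltr0n cardfs_gt0.
  rewrite /rate ler_pdivrMr// mulrDl divfK ?gt_eqF//.
  apply: (@le_trans _ _ (ln (count (window_shift a0 W m) F)%:R +
      ln #|@sparse A a0 F J|%:R)%R); last first.
    by rewrite lerD2l [X in (_ * X%:R)%R]cardfE.
  have cs := count_window_step a0 F J0 cardW Jm.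
  have : (0 < count (bounded_windows a0 W m) F * #|@sparse A a0 F J|)%N.
    exact: leq_trans (pos m.+1 F) cs.
  rewrite muln_gt0 => /andP[p1 p2].
  rewrite -lnM ?posrE ?ltr0n// -natrM ler_ln ?posrE ?ltr0n ?ler_nat ?muln_gt0 ?p1 ?pos//.
have top : (t <= h (J ^ 4)%N)%R.
  apply: le_trans tA _; apply: le_inf_rate => F F0.
  by rewrite -cardW /= window_rate_full.
have exm : exists m, (t <= h m)%R && (J ^ 3 <= m)%N.
  by exists (J ^ 4)%N; rewrite top leq_pexp2l.
(* At the first [m] whose entropy reaches [t], either [m = J ^ 3] and the entropy is at most [e], or
   the entropy at [m - 1] is below [t] and rises by at most [e]. *)
case: (ex_minnP exm) => m /andP[tm Jm] mmin; exists W, m; rewrite tm /=.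
move: Jm; rewrite leq_eqVlt => /orP[/eqP <-|Jm].
  by apply: le_trans bottom _; rewrite lerDr ltW.
case: m Jm tm mmin => // m; rewrite ltnS => Jm tm mmin.
apply: le_trans (step _ (leqW Jm)) _; rewrite lerD2r leNgt; apply/negP => htm.
by have := mmin m; rewrite (ltW htm) Jm ltnn => /(_ isT).
Qed.

(** All entropies are at most 0 here, so [entropy_drop] cannot apply. There is only one
    configuration, and the only other shift is empty, of entropy [-oo]. *)
Lemma trivial_alphabet X : #|A| = 1%N -> (exists x, shift_set X x) ->
  entropy R S X = 0%:E /\ isolated (shifts_ge S A (0 : R)%R) X.
Proof.
move=> A1 X0.
have constE (x y : config G A) : x = y.
  by have [a aP] := fintype1 A1; apply/funext => g; rewrite (aP (x g)) (aP (y g)).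
have ent0 : entropy R S X = 0%:E.
  rewrite entropyE//; congr _%:E; apply/eqP; rewrite eq_le; apply/andP; split.
    by have := inf_rate_max X; rewrite A1 ln1.
  by apply: le_inf_rate => F _; exact: rate_ge0.
split=> //; split; first by rewrite inE /shifts_ge /= ent0.
exists setT; first exact: filterT.
rewrite setTI; apply/seteqP; split=> [Y Yc|_ ->]; last by rewrite /shifts_ge /= ent0.
apply: shift_space_inj; have [x Xx] := X0.
have [[y Yy]|Y0] := pselect (exists y, shift_set Y y).
  by apply/seteqP; split=> z _; [rewrite (constE z x)|rewrite (constE z y)].
by move: Yc; rewrite /shifts_ge /= entropy_empty.
Qed.

End Density.

Theorem theorem1p11 (R : realType) (G : groupType) (A : finType)
    (S : {fset G}) (countG : ([set: G] #= [set: nat])%card)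
    (genS : generates S) (amenG : amenable S R) :
  let I := [set c : R | (0%:E <= c%:E <= lne (#|A|%:R)%:E)%E] in
  exists C : set R,
    [/\ C `<=` I, I `<=` closure C &
        forall c : R, C c ->
          exists X : shift_space G A,
            [/\ strongly_irreducible S X, entropy R S X = c%:E &
                isolated (shifts_ge S A c) X]].
Proof.
move=> I.
(* Taking every value that is realised leaves only the density to prove. *)
exists [set c | I c /\ exists X : shift_space G A,
            [/\ strongly_irreducible S X, entropy R S X = c%:E &
                isolated (shifts_ge S A c) X]].
split; [by move=> c []| |by move=> c []] => t It U /nbhs_ballP[e /= e0 eU].
(* For an empty alphabet [lne 0 = -oo], so [I] is empty. *)
have [A0|/card_gt0P[a0 _]] := posnP #|A|.
  by move: It; rewrite /I /= A0 lexx leeNy_eq andbF.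
have lneA : lne (#|A|%:R)%:E = (ln #|A|%:R : R)%:E.
  by rewrite lne_EFin// ltr0n; apply/card_gt0P; exists a0.
have IE c : I c = (0 <= c <= ln #|A|%:R)%R by rewrite /I lneA.
move: It; rewrite IE => /andP[t0 tA].
have [A1|A1] := leqP #|A| 1.
  have {}A1 : #|A| = 1%N by apply/eqP; rewrite eqn_leq A1; apply/card_gt0P; exists a0.
  have {tA}t0 : t = 0%R by apply/eqP; rewrite eq_le t0 andbT; move: tA; rewrite A1 ln1.
  exists t; split; last by apply: eU; exact: ballxx.
  split; first by rewrite IE t0 A1 ln1 lexx.
  have X0 : exists x, shift_set (window_shift a0 (fset0 : {fset G}) 0) x.
    by exists (fun=> a0); exact: bounded_windows_const.
  have [ent0 iso] := trivial_alphabet a0 genS amenG A1 X0.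
  exists (window_shift a0 fset0 0); rewrite t0; split=> //.
  exact: window_shift_strongly_irreducible.
have lnA : (0 < ln #|A|%:R :> R)%R by rewrite ln_gt0// ltr1n.
(* Isolation needs positive entropy, so [t], which may be 0, is moved up by at most [e / 4] within
   the interval; the entropy found is then within [e / 2] of [t]. *)
pose s : R := Num.max t (Num.min (e / 4)%R (ln #|A|%:R)%R).
have s0 : (0 < s)%R by rewrite lt_max lt_min lnA divr_gt0 ?orbT.
have sA : (s <= ln #|A|%:R)%R by rewrite ge_max tA ge_min lexx orbT.
have ts : (t <= s)%R by rewrite le_max lexx.
have st : (s <= t + e / 4)%R.
  by rewrite ge_max lerDl divr_ge0 ?(ltW e0)//= ge_min lerDr t0.
have [||W [m /andP[sh hs]]] := window_entropies_dense a0 genS amenG countG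
    (t := s) (e := (e / 4)%R).
- by rewrite s0.
- by rewrite divr_gt0.
pose X := window_shift a0 W m.
have X0 : exists x, shift_set X x by exists (fun=> a0); exact: bounded_windows_const.
have h0 : (0 < inf_rate R X)%R by exact: lt_le_trans sh.
exists (inf_rate R X); split; last first.
  apply: eU; rewrite /ball /= ltr_norml; apply/andP; split; lra.
split.
  by rewrite IE ltW//=; exact: (inf_rate_max R a0).
have irrX := window_shift_strongly_irreducible a0 S W m.
have entX := entropyE genS amenG X0.
have [V XV VX] := window_shift_nbhs a0 W m.
exists X; split => //.
exact: (isolated_strongly_irreducible genS amenG irrX h0 entX X0 XV).
Qed.
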